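(* Assume that $A_n$ is an $n\times n$ matrix ($n=4k$) with elements either $+1$ or $-1$. For $n$ large enough, if $A_n$ can be realized by a Riemann integrable function $f$ defined on $[0,1]$, where $|f(t)|\leqslant 1$, in the sense that $A_n=A_{f,n}$, then $A_n$ is not a Hadamard matrix.
   Context: For a function $f$ on $[0,1]$, $A_{f,n}$ denotes the symmetric $n\times n$ matrix whose $(i,j)$ entry is $f\bigl(\min(i,j)/\max(i,j)\bigr)$ for $1\le i,j\le n$. A Hadamard matrix of order $n$ is an $n\times n$ matrix $H$ with all entries $+1$ or $-1$ such that $H H^{T}=nI_n$, where $I_n$ is the identity matrix. Here $k$ is a positive integer. *)

(* Defs.v *)
From Stdlib Require Import Reals.
From Coquelicot Require Import Coquelicot.
From mathcomp Require Import all_boot all_order all_algebra.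
From mathcomp Require Import Rstruct.

Set Implicit Arguments.
Unset Strict Implicit.
Unset Printing Implicit Defensive.

Import Order.TTheory GRing.Theory Num.Theory.

Local Open Scope ring_scope.

(* Ordinals start at 0, so the ordinal i stands for the index i.+1. *)
Definition ratio_mx (f : R -> R) (n : nat) : 'M[R]_n :=
  \matrix_(i < n, j < n)
    f ((minn i.+1 j.+1)%:R / (maxn i.+1 j.+1)%:R).

Definition pm1_mx (n : nat) (A : 'M[R]_n) : Prop :=
  forall i j : 'I_n, A i j = 1 \/ A i j = -1.

Definition hadamard (n : nat) (H : 'M[R]_n) : Prop :=
  pm1_mx H /\ H *m H^T = n%:R%:M.

(* Main.v *)
Require Import Defs.
From Stdlib Require Import Reals.
From Coquelicot Require Import Coquelicot.
From mathcomp Require Import all_boot all_order all_algebra.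
From mathcomp Require Import Rstruct.
From mathcomp Require Import ring lra zify.

Set Implicit Arguments.
Unset Strict Implicit.
Unset Printing Implicit Defensive.

Import Order.TTheory GRing.Theory Num.Theory.

Local Open Scope ring_scope.

(** Two consecutive rows of [ratio_mx f n] are almost equal when [f] is Riemann
    integrable, whereas two rows of a Hadamard matrix differ in half of their
    entries.

    In column [k < n], row [n] holds [f (k / n)] and row [n - 1] holds
    [f (k / (n - 1))].  Both arguments lie in the interval
    [[k / n, (k + 1) / n]], so the sum over [k] of the differences
    [`|f (k / n) - f (k / (n - 1))|], divided by [n], is a difference of two
    Riemann sums of [f] on the uniform subdivision of [[0, 1]]; it tends to [0]
    ([RInt_sum_osc]).  For entries [1] and [-1] one has [`|u - v| = 1 - u * v],
    and orthogonality of the two rows makes the sum of [1 - u * v] over the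
    first [n - 1] columns at least [n - 2]. *)

(** * Riemann sums on uniform subdivisions *)

(** Coquelicot's [SF_seq_f2] computes the tag of an interval from its endpoints;
    here it may depend on the index of the interval as well.  As in [unif_part],
    [n] stands for [n.+1] intervals. *)
Definition unif_tagged (n : nat) (xi : nat -> R) : @SF_seq R :=
  mkSF_seq 0 (mkseq (fun k => (k.+1%:R / n.+1%:R, xi k)) n.+1).

Definition unif_tags (n : nat) (xi : nat -> R) : Prop :=
  forall k, (k <= n)%N -> k%:R / n.+1%:R <= xi k <= k.+1%:R / n.+1%:R.

Lemma unif_tagged_lx n xi : SF_lx (unif_tagged n xi) = unif_part 0 1 n.
Proof.
have unif_partE k :
    (0 + INR k * (1 - 0) / (INR n + 1))%R = k%:R / n.+1%:R :> R.
  by rewrite !RealsE add0r subr0 mulr1 -natr1.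
rewrite /unif_part (eq_mkseq unif_partE) /SF_lx /unif_tagged /=.
rewrite /mkseq /= mul0r; congr (_ :: _ :: _).
rewrite /unzip1 -map_comp -(addn1 1) iotaDl -map_comp.
by apply: eq_map => k /=; rewrite add1n.
Qed.

Lemma unif_tagged_sum (f : R -> R) n xi :
  Riemann_sum f (unif_tagged n xi) = (\sum_(k < n.+1) f (xi k)) / n.+1%:R.
Proof.
pose pt k : R * R := (k.+1%:R / n.+1%:R, xi k).
have lastE m : last 0 (0 :: unzip1 (mkseq pt m)) = m%:R / n.+1%:R :> R.
  case: m => [|m]; first by rewrite /= mul0r.
  by rewrite mkseqS /unzip1 map_rcons /= last_rcons.
suff partial m : Riemann_sum f (mkSF_seq 0 (mkseq pt m)) =
    (\sum_(k < m) f (xi k)) / n.+1%:R by exact: partial.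
elim: m => [|m IHm]; first by rewrite big_ord0 mul0r.
rewrite mkseqS -[mkSF_seq _ _]/(SF_rcons (mkSF_seq 0 (mkseq pt m)) (pt m)).
rewrite Riemann_sum_rcons IHm [last _ _]lastE big_ord_recr /=.
rewrite /plus /scal /= /mult /= !RealsE -natr1.
ring.
Qed.

Lemma unif_tagged_pointed n xi :
  unif_tags n xi -> pointed_subdiv (unif_tagged n xi).
Proof.
move=> tags k; rewrite /SF_size size_mkseq => /ssrnat.ltP lekn.
have [/RleP lo /RleP hi] := andP (tags k lekn).
have -> : nth 0%R (SF_ly (unif_tagged n xi)) k = xi k.
  by rewrite /SF_ly (nth_map (0, 0)) ?size_mkseq // nth_mkseq.
have lxE i : (i <= n.+1)%N ->
    nth 0%R (SF_lx (unif_tagged n xi)) i = i%:R / n.+1%:R.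
  case: i => [|i] lein; first by rewrite mul0r.
  rewrite -[LHS]/(nth 0%R (unzip1 (SF_t (unif_tagged n xi))) i).
  by rewrite (nth_map (0, 0)) ?size_mkseq // nth_mkseq.
by rewrite !lxE // ltnW.
Qed.

Lemma is_RInt_unif_tagged (f : R -> R) (I : R) (eps : R) :
    is_RInt f 0 1 I -> 0 < eps ->
  exists N, forall n xi, (N <= n)%N -> unif_tags n xi ->
    `|(\sum_(k < n.+1) f (xi k)) / n.+1%:R - I| < eps.
Proof.
move=> intf /RltP eps_gt0.
have [delta fine] := intf _ (locally_ball I (mkposreal eps eps_gt0)).
have delta_gt0 : 0 < (delta : R) by apply/RltP; exact: cond_pos.
exists (Num.truncn (delta : R)^-1) => n xi leNn tags.
have {fine} := fine (unif_tagged n xi).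
rewrite unif_tagged_lx last_unif_part.
rewrite Rmin_left ?Rmax_right; try exact: Rle_0_1.
have mesh_small : Rlt (seq_step (unif_part 0 1 n)) delta.
  apply/RltP; rewrite seq_step_unif_part !RealsE subr0 div1r natr1.
  rewrite ger0_norm ?invr_ge0 // -[ltRHS]invrK.
  rewrite ltf_pV2 ?posrE ?invr_gt0 //.
  apply: lt_le_trans (truncnS_gt _) _.
  by rewrite ler_nat.
move=> /(_ mesh_small) /(_ (conj (unif_tagged_pointed tags) (conj erefl erefl))).
rewrite unif_tagged_sum.
have -> : sign (Rminus 1 0) = 1.
  by rewrite Rminus_0_r; apply: sign_eq_1; exact: Rlt_0_1.
rewrite scal_one /ball /= /AbsRing_ball /= /abs /= /minus /plus /opp /=.
by move/RltP; rewrite !RealsE.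
Qed.

(** Choosing in each interval the point where [f] is larger, respectively
    smaller, turns the sum of absolute differences into a difference of two
    Riemann sums, both close to the integral. *)
Lemma RInt_sum_osc (f : R -> R) (eps : R) :
    ex_RInt f 0 1 -> 0 < eps ->
  exists N, forall n x y, (N <= n)%N -> unif_tags n x -> unif_tags n y ->
    \sum_(k < n.+1) `|f (x k) - f (y k)| < eps * n.+1%:R.
Proof.
move=> [I intf] eps_gt0.
have eps2_gt0 : 0 < eps / 2 by lra.
have [N closeN] := is_RInt_unif_tagged intf eps2_gt0.
exists N => n x y leNn tagx tagy.
pose hi k := if f (x k) <= f (y k) then y k else x k.
pose lo k := if f (x k) <= f (y k) then x k else y k.
have taghi : unif_tags n hi.
  by move=> k lekn; rewrite /hi; case: ifP => _; [exact: tagy|exact: tagx].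
have taglo : unif_tags n lo.
  by move=> k lekn; rewrite /lo; case: ifP => _; [exact: tagx|exact: tagy].
have -> : \sum_(k < n.+1) `|f (x k) - f (y k)| =
    \sum_(k < n.+1) f (hi k) - \sum_(k < n.+1) f (lo k).
  rewrite -sumrB; apply: eq_bigr => k _.
  rewrite /hi /lo; case: ifP => [lexy|/negbT].
    by rewrite distrC ger0_norm ?subr_ge0.
  by rewrite -ltNge => /ltW leyx; rewrite ger0_norm ?subr_ge0.
rewrite -ltr_pdivrMr ?ltr0Sn // mulrBl.
have close_sub (u v J : R) :
    `|u - J| < eps / 2 -> `|v - J| < eps / 2 -> u - v < eps.
  by rewrite !ltr_norml => /andP[? ?] /andP[? ?]; lra.
exact: close_sub (closeN n hi leNn taghi) (closeN n lo leNn taglo).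
Qed.

(** * Consecutive rows of a ratio matrix *)

Lemma pm1_dist (u v : R) :
  u = 1 \/ u = -1 -> v = 1 \/ v = -1 -> `|u - v| = 1 - u * v.
Proof.
case=> ->; case=> ->; rewrite ?subrr ?normr0 ?opprK; [lra| | |lra].
- by rewrite ger0_norm; lra.
- by rewrite ler0_norm; lra.
Qed.

Lemma ratio_mx_le f n (i c : 'I_n) :
  (c <= i)%N -> ratio_mx f n i c = f (c.+1%:R / i.+1%:R).
Proof.
by move=> leci; rewrite mxE (minn_idPr _) ?(maxn_idPl _).
Qed.

Lemma hadamard_row_orthogonal n (H : 'M[R]_n) (i j : 'I_n) :
  hadamard H -> i != j -> \sum_c H i c * H j c = 0.
Proof.
case=> _ /matrixP /(_ i j) + /negPf neqij; rewrite !mxE neqij mulr0n => prod0.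
by rewrite -[RHS]prod0; apply: eq_bigr => c _; rewrite mxE.
Qed.

Lemma unif_tags_left n : unif_tags n (fun k => k%:R / n.+1%:R).
Proof. by move=> k _; rewrite lexx ler_pM2r ?invr_gt0 // ler_nat leqnSn. Qed.

Lemma unif_tags_pred n : (0 < n)%N -> unif_tags n (fun k => k%:R / n%:R).
Proof.
move=> n_gt0 k lekn.
rewrite ler_pdivlMr ?ltr0n // mulrAC ler_pdivrMr ?ltr0Sn //.
rewrite ler_pdivlMr ?ltr0Sn // mulrAC ler_pdivrMr ?ltr0n //.
rewrite -!natrM !ler_nat; apply/andP; split; nia.
Qed.

Theorem mainTheorem5 (f : R -> R)
    (f_int : ex_RInt f 0 1)
    (f_bound : forall t : R, 0 <= t <= 1 -> `|f t| <= 1) :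
  exists N : nat, forall n k : nat,
    (0 < k)%N -> n = (4 * k)%N -> (N <= n)%N ->
    forall A : 'M[R]_n,
      pm1_mx A -> A = ratio_mx f n -> ~ hadamard A.
Proof.
(* Any constant below 1/2 would do: orthogonality forces a sum of at least n - 2,
   and n >= 4. *)
have quarter_gt0 : 0 < 4^-1 :> R by lra.
have [N oscN] := RInt_sum_osc f_int quarter_gt0.
exists N.+1 => n k k_gt0 n4k ltNn A pmA A_ratio hadA.
case: n n4k ltNn A pmA A_ratio hadA => [|n] n4k leNn A pmA A_ratio hadA; first by lia.
have n_ge3 : (3 <= n)%N by lia.
have n_gt0 : (0 < n)%N by lia.
have := oscN n _ _ leNn (unif_tags_left (n := n)) (unif_tags_pred n_gt0).
(* The interval with index 0 contributes nothing, both of its tags being 0. *)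
rewrite big_ord_recl /= !mul0r subrr normr0 add0r.
pose last_row : 'I_n.+1 := ord_max.
pose prev_row : 'I_n.+1 := inord n.-1.
have prev_rowE : prev_row = n.-1 :> nat by rewrite inordK; lia.
have rowE (c : 'I_n) (w := widen_ord (leqnSn n) c) :
    `|f ((bump 0 c)%:R / n.+1%:R) - f ((bump 0 c)%:R / n%:R)| =
    1 - A last_row w * A prev_row w.
  rewrite -pm1_dist // A_ratio !ratio_mx_le /= ?prev_rowE ?prednK //.
    by have := ltn_ord c; lia.
  exact: ltnW.
under eq_bigr do rewrite rowE.
have neq_rows : last_row != prev_row.
  by rewrite -val_eqE /= prev_rowE; lia.
have := hadamard_row_orthogonal hadA neq_rows.
rewrite big_ord_recr /= sumrB sumr_const card_ord => orth.
have last_le1 : - (A last_row ord_max * A prev_row ord_max) <= 1.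
  by case: (pmA last_row ord_max) => ->; case: (pmA prev_row ord_max) => ->; lra.
have : 3 <= n%:R :> R by rewrite (ler_nat _ 3).
rewrite -natr1; lra.
Qed.
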